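(* Let $G$ be a finite group. If $d^*(G)>\frac{1}{2}=d^*(A_4)=d'(A_4)$, then $G$ is supersolvable. (That is: $d^*(A_4)=d'(A_4)=\frac{1}{2}$, and every finite group $G$ with $d^*(G)>\frac{1}{2}$ is supersolvable.)
   Context: For a finite group $G$, let $L(G)$ denote the set (lattice) of all subgroups of $G$, and let $k'(G)$ denote the number of conjugacy classes of subgroups of $G$ (i.e. the number of orbits of $G$ acting on $L(G)$ by conjugation). Define $d'(G)=\frac{k'(G)}{|L(G)|}$. A section of $G$ is a quotient group $H/N$, where $H,N$ are subgroups of $G$ and $N$ is a normal subgroup of $H$. Define $d^*(G)=\min\{d'(S)\mid S \text{ is a section of } G\}$. $A_4$ is the alternating group of degree 4. A group is supersolvable if it has a finite series of subgroups, each normal in the whole group, from the trivial subgroup to the whole group, with cyclic successive factors. *)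

(* Defs.v *)
From mathcomp Require Import all_boot all_order all_algebra.
From mathcomp Require Import all_fingroup all_solvable.

Set Implicit Arguments.
Unset Strict Implicit.
Unset Printing Implicit Defensive.

Import Order.TTheory GRing.Theory Num.Theory.

Local Open Scope ring_scope.
Local Open Scope group_scope.

(* L(G) is [subgroups G]; G acts on it by conjugation through 'JG. *)
Definition subgroup_classes (gT : finGroupType) (G : {group gT}) :
    {set {set {group gT}}} :=
  orbit 'JG%act G @: subgroups G.

Definition dprime (gT : finGroupType) (G : {group gT}) : rat :=
  (#|subgroup_classes G|%:R / #|subgroups G|%:R)%R.

(* The library type [section gT] consists of arbitrary pairs of subgroups of
   gT, written (H / N)%sec, so the inclusion H <= G and the normality of N in
   H have to be imposed. *)
Definition section_in (gT : finGroupType) (G : {group gT}) (s : section gT) :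
    bool :=
  (s.1 \subset G) && (s.2 <| s.1).

Definition dprime_section (gT : finGroupType) (s : section gT) : rat :=
  dprime (section_group s).

(* The base point (G / 1)%sec of the arg min is itself a section of G. *)
Definition dstar (gT : finGroupType) (G : {group gT}) : rat :=
  dprime_section
    [arg min_(s < (G / 1)%sec | section_in G s) dprime_section s]%O.

Lemma dstarP (gT : finGroupType) (G : {group gT}) :
  (exists2 s, section_in G s & dstar G = dprime_section s) /\
  (forall s, section_in G s -> (dstar G <= dprime_section s)%R).
Proof.
rewrite /dstar; case: Order.TotalTheory.arg_minP => [|s Gs min_s].
  by rewrite /section_in /= subxx normal1.
by split=> //; exists s.
Qed.

Definition supersolvable_factor (gT : finGroupType) (A V U : {set gT}) : bool :=
  [&& V <| A, U <| A, V \subset U & cyclic (U / V)].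

Definition supersolvable (gT : finGroupType) (G : {group gT}) : Prop :=
  exists2 s : seq {group gT},
    (supersolvable_factor G).-series 1%G s & last 1%G s = G.

(* Main.v *)
Require Import Defs.
From mathcomp Require Import all_boot all_order all_algebra.
From mathcomp Require Import all_fingroup all_solvable zify.

(** If d* > 1/2 on G, the same holds on every section of G, so in a minimal
    non-supersolvable G all proper subgroups and all proper quotients are
    supersolvable.  Subgroup classes of size 1 are exactly the normal subgroups;
    hence d'(G) <= 1/2 as soon as the classes c of size at least 2 satisfy
    \sum (#|c| - 2) >= (number of normal subgroups).
    - If G is simple nonabelian, the classes of Sylow subgroups for two primes
      have size at least 3 and outweigh the normal subgroups 1 and G.
    - Otherwise a minimal normal subgroup N is elementary abelian, noncyclic,
      and contained in every nontrivial normal subgroup.  Let C = C_G(N), K / C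
      be minimal normal in G / C, and Q be a Sylow subgroup of K with K = C Q.
      By the Frattini argument G = C N_G(Q), so N is still minimal normal in
      N N_G(Q); as N is not cyclic this is all of G, and N_G(Q) is a complement
      M of N acting faithfully.  A normal subgroup H other than 1 and N gives
      the class of H :&: M, of size at least #|N|, and this is injective in H.
      When #|N| = 4 the class of subgroups of order 2 of N is needed as well.
    A_4 enters only through its order 12 and the absence of a normal subgroup of
    order 3; its proper sections are then all abelian. *)

Set Implicit Arguments.
Unset Strict Implicit.
Unset Printing Implicit Defensive.

Import Order.TTheory GRing.Theory Num.Theory.

Local Open Scope group_scope.

(** * Conjugacy classes of subgroups; isomorphism invariance *)

Lemma mem_orbitJG (gT : finGroupType) (G H K : {group gT}) :
  reflect (exists2 g, g \in G & K :=: H :^ g) (K \in orbit 'JG%act G H).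
Proof.
apply: (iffP orbitP) => [[g Gg <-]|[g Gg defK]]; first by exists g.
by exists g => //; apply: val_inj.
Qed.

Lemma acts_subgroups (gT : finGroupType) (G : {group gT}) :
  [acts G, on subgroups G | 'JG].
Proof.
apply/actsP=> g Gg H; rewrite !inE /=.
by rewrite -{1}(conjGid Gg) conjSg.
Qed.

Lemma subgroup_classes_sub (gT : finGroupType) (G : {group gT})
    (c : {set {group gT}}) :
  c \in subgroup_classes G -> c \subset subgroups G.
Proof.
by case/imsetP=> H LH ->; rewrite acts_sub_orbit ?acts_subgroups.
Qed.

Lemma card_subgroups_gt0 (gT : finGroupType) (G : {group gT}) :
  (0 < #|subgroups G|)%N.
Proof. by apply/card_gt0P; exists G; rewrite inE /=. Qed.

Lemma dprime_isog (gT rT : finGroupType) (G : {group gT}) (H : {group rT}) :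
  G \isog H -> dprime G = dprime H.
Proof.
case/isogP=> f injf defH; rewrite /dprime.
pose F (K : {group gT}) := (f @* K)%G.
have injF: {in subgroups G &, injective F}.
  move=> A B; rewrite !inE => sAG sBG /(congr1 val)/= /(injm_morphim_inj injf).
  by move=> AB; apply: val_inj; apply: AB.
have defS: F @: subgroups G = subgroups H.
  apply/setP=> K; apply/imsetP/idP => [[A] |].
    by rewrite !inE => sAG ->; rewrite /= -defH morphimS.
  rewrite inE -defH => sK; exists (f @*^-1 K)%G; rewrite ?inE /= ?subsetIl //.
  by apply: val_inj; rewrite /= morphpreK // (subset_trans sK) ?morphimS.
have orbF A: A \in subgroups G -> orbit 'JG H (F A) = F @: orbit 'JG G A.
  rewrite inE => sAG; apply/setP=> K; apply/mem_orbitJG/imsetP.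
    case=> y; rewrite -defH => /morphimP[x Gx _ ->] defK.
    exists (A :^ x)%G; first by apply/mem_orbitJG; exists x.
    by apply: val_inj; rewrite /= defK morphimJ.
  case=> B /mem_orbitJG[x Gx defB] ->; exists (f x).
    by rewrite -defH mem_morphim.
  by rewrite /= defB morphimJ.
have defC: subgroup_classes H =
    (fun c : {set {group gT}} => F @: c) @: subgroup_classes G.
  rewrite /subgroup_classes -defS -!imset_comp.
  by apply: eq_in_imset => A LA /=; rewrite orbF.
have injC: {in subgroup_classes G &,
             injective (fun c : {set {group gT}} => F @: c)}.
  (* A class can be recovered from its image because [F] is injective on the subgroups of [G], where
     every class lives. *)
  have rec c: c \in subgroup_classes G ->
      c = [set K in subgroups G | F K \in F @: c].
    move/subgroup_classes_sub=> sc; apply/setP=> K; rewrite in_set.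
    apply/idP/andP=> [cK|[LK /imsetP[A cA]]].
      by rewrite (subsetP sc) // imset_f.
    by move/injF=> -> //; apply: (subsetP sc).
  by move=> c d /rec defc /rec defd /= eqcd; rewrite defc defd eqcd.
by rewrite defC -defS (card_in_imset injC) (card_in_imset injF).
Qed.

(** * Heredity of the hypothesis and the counting criterion *)

(** The condition d*(G) > 1/2 with the minimum unfolded; in this form it passes to subgroups and
    quotients directly. *)
Definition dprime_sections_gt_half (gT : finGroupType) (G : {group gT}) :=
  forall s, section_in G s -> (1 / 2%:R < dprime_section s)%R.

Lemma sections_gt_halfS (gT : finGroupType) (G H : {group gT}) :
  H \subset G -> dprime_sections_gt_half G -> dprime_sections_gt_half H.
Proof.
move=> sHG gtG s /andP[sH n]; apply: gtG.
by rewrite /section_in (subset_trans sH).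
Qed.

Lemma sections_gt_half_self (gT : finGroupType) (G : {group gT}) :
  dprime_sections_gt_half G -> (1 / 2%:R < dprime G)%R.
Proof.
move=> gtG; have /gtG: section_in G (G / 1)%sec.
  by rewrite /section_in /= subxx normal1.
by rewrite /dprime_section -(dprime_isog (quotient1_isog G)).
Qed.

(** A section of [G / N] has the form (H / N) / (K / N), and the third isomorphism theorem
    identifies it with the section H / K of [G]. *)
Lemma sections_gt_half_quotient (gT : finGroupType) (G N : {group gT}) :
  N <| G -> dprime_sections_gt_half G -> dprime_sections_gt_half (G / N)%G.
Proof.
move=> nNG gtG [[A B]] /andP[/= sA nBA].
have [H defH sNH sHG] := inv_quotientS nNG sA.
have nNH := normalS sNH sHG nNG.
have nBH : B <| H / N by rewrite -defH.
have [K defK sNK nKH] := inv_quotientN nNH nBH.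
have /gtG: section_in G (H / K)%sec by rewrite /section_in /= sHG nKH.
rewrite /dprime_section; congr (_ < _)%R.
rewrite -(dprime_isog (third_isog sNK nNH nKH)).
by rewrite (group_inj defH) (group_inj defK).
Qed.

Lemma dprime_le_half (gT : finGroupType) (G : {group gT}) :
  (dprime G <= 1 / 2%:R)%R = (2 * #|subgroup_classes G| <= #|subgroups G|)%N.
Proof.
rewrite /dprime ler_pdivrMr ?ltr0n ?card_subgroups_gt0 //.
by rewrite mul1r mulrC ler_pdivlMr ?ltr0n // -natrM ler_nat mulnC.
Qed.

Lemma dprime_ge_half (gT : finGroupType) (G : {group gT}) :
  (1 / 2%:R <= dprime G)%R = (#|subgroups G| <= 2 * #|subgroup_classes G|)%N.
Proof.
rewrite /dprime ler_pdivlMr ?ltr0n ?card_subgroups_gt0 //.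
by rewrite mul1r mulrC ler_pdivrMr ?ltr0n // -natrM ler_nat mulnC.
Qed.

Lemma card_orbitJG (gT : finGroupType) (G H : {group gT}) :
  #|orbit 'JG%act G H| = #|G : 'N_G(H)|.
Proof. by rewrite card_orbit astab1JG. Qed.

Definition normal_subgroups (gT : finGroupType) (G : {group gT}) :=
  [set H : {group gT} | H <| G].

(** Subtraction is truncated, so every class satisfies 2 + (#|c| - 2) = #|c| + (#|c| == 1). Summing
    over the classes, with the singletons bounded by the normal subgroups, gives the inequality. *)
Lemma dprime_le_half_excess (gT : finGroupType) (G : {group gT}) :
  (#|normal_subgroups G| <= \sum_(c in subgroup_classes G) (#|c| - 2))%N ->
  (dprime G <= 1 / 2%:R)%R.
Proof.
rewrite dprime_le_half => leN.
set C := subgroup_classes G in leN *.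
have sumL: (\sum_(c in C) #|c| = #|subgroups G|)%N.
  exact: acts_sum_card_orbit (acts_subgroups G).
have c_gt0 c: c \in C -> (0 < #|c|)%N.
  by case/imsetP=> H _ ->; apply/card_gt0P; exists H; apply: orbit_refl.
have leS: (\sum_(c in C) (#|c| == 1%N) <= #|normal_subgroups G|)%N.
  rewrite -big_mkcondr sum1_card.
  rewrite -(card_imset _ (@set1_inj {group gT})); apply: subset_leq_card.
  apply/subsetP=> c; rewrite unfold_in => /andP[/imsetP[H LH ->] /eqP oc].
  apply/imsetP; exists H; last exact: card_orbit1.
  rewrite inE in LH; rewrite inE /normal LH /=; move/eqP: oc.
  by rewrite card_orbitJG indexg_eq1 subsetI subxx.
rewrite -sumL -(leq_add2r (\sum_(c in C) (#|c| == 1%N))).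
apply: leq_trans (_ : 2 * #|C| + \sum_(c in C) (#|c| - 2) <= _)%N.
  by rewrite leq_add2l (leq_trans leS).
rewrite mulnC -sum_nat_const -!big_split /=; apply: leq_sum => c /c_gt0.
by case: #|c| => [|[|n]] // _; rewrite addn0 /= !subSS subn0 !add2n.
Qed.

Lemma dprime_le_half_excess_classes (gT : finGroupType) (G : {group gT})
    (C : {set {set {group gT}}}) :
  C \subset subgroup_classes G ->
  (#|normal_subgroups G| <= \sum_(c in C) (#|c| - 2))%N ->
  (dprime G <= 1 / 2%:R)%R.
Proof.
move=> sC leC; apply: dprime_le_half_excess; apply: leq_trans leC _.
rewrite [leqRHS](big_setID C) /= (setIidPr sC) leq_addr //.
Qed.

(** * Supersolvable series and minimal normal subgroups *)

(** For trivial [D] this is [supersolvable G]. The free starting point allows induction along the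
    series and holds the preimage of a series of [G / D]. *)
Definition supersolvable_from (gT : finGroupType) (G D : {group gT}) : Prop :=
  exists2 s : seq {group gT},
    (supersolvable_factor G).-series D s & last D s = G.

Lemma supersolvable_from_quotient (gT : finGroupType) (G D : {group gT}) :
  D <| G -> supersolvable (G / D)%G -> supersolvable_from G D.
Proof.
move=> nDG [s ss last_s]; pose F K := (coset D @*^-1 K)%G.
have F1: F 1%G = D by apply: val_inj; rewrite /= -kerE ker_coset.
have FG: F (G / D)%G = G by apply: val_inj; rewrite /= quotientGK.
exists (map F s); last by rewrite -{1}F1 last_map last_s.
rewrite -{1}F1; elim: s 1%G ss {last_s} => //= U s IHs V /andP[/and4P[nV nU sVU cyc]].
move/IHs->; rewrite andbT -{1}FG /supersolvable_factor /= !cosetpre_normal nV nU.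
have sDpre (W : {group coset_of D}): D \subset coset D @*^-1 W by exact: sub_cosetpre.
rewrite cosetpreSK sVU /=.
have nDU: D <| F U by apply: normal_cosetpre.
have nVU: F V <| F U.
  by rewrite cosetpre_normal (normalS sVU (normal_sub nU)).
by rewrite -(isog_cyclic (third_isog (sDpre V) nDU nVU)) /= !cosetpreK.
Qed.

Lemma supersolvable_cyclic_ext (gT : finGroupType) (G N : {group gT}) :
  N <| G -> cyclic N -> supersolvable_from G N -> supersolvable G.
Proof.
move=> nNG cycN [s ss last_s]; exists (N :: s) => //=.
by rewrite ss /supersolvable_factor normal1 nNG sub1G quotient_cyclic.
Qed.

Lemma minnormal_normal (gT : finGroupType) (G N : {group gT}) :
  minnormal N G -> N \subset G -> N <| G.
Proof. by case/mingroupP=> /andP[_ nNG] _ sNG; rewrite /normal sNG. Qed.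

Lemma minnormal_sub (gT : finGroupType) (G N D : {group gT}) :
  minnormal N G -> G \subset 'N(D) -> N :&: D != 1 -> N \subset D.
Proof.
case/mingroupP=> /andP[_ nNG] minN nDG ntI.
by apply/setIidPl/minN; rewrite ?subsetIl // ntI normsI.
Qed.

(** The first term of the series that meets [N] nontrivially contains [N] by minimality, so [N]
    embeds in the cyclic factor just below that term. *)
Lemma minnormal_cyclic (gT : finGroupType) (G N D : {group gT}) :
  supersolvable_from G D -> minnormal N G -> N \subset G -> N :&: D = 1 ->
  cyclic N.
Proof.
case=> s ss last_s minN sNG; have /andP[ntN nNG] := mingroupp minN.
elim: s D ss last_s => [|U s IHs] D /= => [_ ->|].
  by rewrite (setIidPl sNG) => N1; rewrite N1 eqxx in ntN.
case/andP=> /and4P[nDG nUG sDU cycUD] /IHs{}IHs /IHs{}IHs tiND.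
have [/eqP/IHs//|ntI] := boolP (N :&: U == 1).
have sNU := minnormal_sub minN (normal_norm nUG) ntI.
have nDN := subset_trans sNG (normal_norm nDG).
rewrite (isog_cyclic (quotient_isog nDN _)); last by rewrite setIC.
exact: cyclicS (quotientS _ sNU) cycUD.
Qed.

Lemma supersolvable_solvable (gT : finGroupType) (G : {group gT}) :
  supersolvable G -> solvable G.
Proof.
case=> s; have: solvable (1%G : {group gT}) := solvable1 _.
elim: s 1%G => [|U s IHs] D solD /= => [_ <- //|].
case/andP=> /and4P[nDG nUG sDU cycUD] ss; apply: IHs => //.
rewrite (series_sol (normalS sDU (normal_sub nUG) nDG)) solD.
exact: abelian_sol (cyclic_abelian cycUD).
Qed.

(** * Simple nonabelian groups *)

Lemma class_card (gT : finGroupType) (G H K : {group gT}) :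
  K \in orbit 'JG%act G H -> #|K| = #|H|.
Proof. by case/mem_orbitJG=> g _ ->; rewrite cardJg. Qed.

Lemma subgroup_classes_orbit (gT : finGroupType) (G H : {group gT}) :
  H \subset G -> orbit 'JG%act G H \in subgroup_classes G.
Proof. by move=> sHG; apply: imset_f; rewrite inE. Qed.

(** A normalizer of index 1 makes [H] normal. One of index 2 is itself normal, hence trivial, and
    then [G] has order 2. *)
Lemma simple_class_gt2 (gT : finGroupType) (G H : {group gT}) :
    simple G -> ~~ abelian G -> H \subset G -> H :!=: 1 -> H :!=: G ->
  (2 < #|orbit 'JG%act G H|)%N.
Proof.
case/simpleP=> ntG simG not_cGG sHG ntH prH; rewrite card_orbitJG.
have := indexg_gt0 G 'N_G(H).
case oI: #|G : 'N_G(H)| => [|[|[|n]]] // _.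
  move/eqP: oI; rewrite indexg_eq1 subsetI subxx /= => nHG.
  have /simG[] : H <| G by rewrite /normal sHG.
    by move/eqP; rewrite (negPf ntH).
  by move/eqP; rewrite (negPf prH).
have [N1|NG] := simG _ (index2_normal (subsetIl _ _) oI).
  rewrite N1 indexg1 in oI.
  by case/negP: not_cGG; rewrite cyclic_abelian ?prime_cyclic ?oI.
by rewrite NG indexgg in oI.
Qed.

Lemma simple_not_pgroup (gT : finGroupType) (G : {group gT}) (p : nat) :
  simple G -> ~~ abelian G -> ~~ p.-group G.
Proof.
case/simpleP=> ntG simG; apply: contra => pG.
have [Z1|/center_idP//] := simG _ (center_normal G).
by move: ntG; rewrite -(trivg_center_pgroup pG) ?Z1 ?eqxx.
Qed.

Lemma dprime_simple (gT : finGroupType) (G : {group gT}) :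
  simple G -> ~~ abelian G -> (dprime G <= 1 / 2%:R)%R.
Proof.
move=> simG not_cGG; have [ntG norG] := simpleP _ simG.
pose p := pdiv #|G|.
have p_pr: prime p by rewrite pdiv_prime ?cardG_gt1.
have not_pG := simple_not_pgroup p simG not_cGG.
have [q [q_pr q_dv neq_qp]]: exists q, [/\ prime q, q %| #|G| & q != p].
  move: not_pG; rewrite /pgroup /pnat cardG_gt0 -has_predC => /hasP[q].
  by rewrite mem_primes => /and3P[q_pr _ q_dv] neq; exists q.
have [P sylP] := Sylow_exists p G; have [Q sylQ] := Sylow_exists q G.
have ntS r (R : {group gT}) : prime r -> r %| #|G| -> r.-Sylow(G) R ->
    [/\ r %| #|R|, R :!=: 1 & (2 < #|orbit 'JG%act G R|)%N].
  move=> r_pr r_dv sylR.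
  have rR: r %| #|R|.
    rewrite (card_Hall sylR) p_part -{1}(expn1 r) dvdn_exp2l //.
    by rewrite logn_gt0 mem_primes r_pr cardG_gt0.
  have ntR: R :!=: 1.
    by apply: contraTneq rR => ->; rewrite cards1 dvdn1; rewrite gtn_eqF ?prime_gt1.
  split=> //; apply: simple_class_gt2 => //; first exact: pHall_sub sylR.
  apply: contraNneq (simple_not_pgroup r simG not_cGG) => <-.
  exact: pHall_pgroup sylR.
have [pP ntP clP] := ntS p P p_pr (pdiv_dvd _) sylP.
have [qQ ntQ clQ] := ntS q Q q_pr q_dv sylQ.
apply: (@dprime_le_half_excess_classes _ G [set orbit 'JG%act G P; orbit 'JG%act G Q]).
  by rewrite subUset !sub1set !subgroup_classes_orbit ?(pHall_sub sylP) ?(pHall_sub sylQ).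
rewrite big_setU1 ?big_set1 /=; last first.
  rewrite inE; apply: contraNneq neq_qp => eqPQ.
  (* If the two classes coincided, [q] would divide the order of the p-group [P]. *)
  have /class_card oPQ: P \in orbit 'JG%act G Q by rewrite -eqPQ orbit_refl.
  rewrite -oPQ in qQ; have := pnatP _ (cardG_gt0 P) (pHall_pgroup sylP).
  by apply.
apply: (@leq_trans 2); last by rewrite -[2]/(1 + 1)%N leq_add ?subn_gt0.
rewrite (leq_trans (subset_leq_card (_ : _ \subset [set 1%G; G]))) //.
  by apply/subsetP=> H; rewrite !inE -!val_eqE /= => /norG[->|->]; rewrite eqxx ?orbT.
by rewrite cards2 -[(_ == _)]val_eqE /=; case: eqP.
Qed.

(** * Noncyclic abelian minimal normal subgroups with a complement *)

(** If [G] centralized [N], it would normalize <[x]> for a nontrivial x in [N], and minimality would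
    put [N] inside <[x]>. *)
Lemma noncyclic_minnormal_cent (gT : finGroupType) (G N : {group gT}) :
  minnormal N G -> ~~ cyclic N -> ~~ (G \subset 'C(N)).
Proof.
move=> minN; apply: contra => cGN; have /andP[ntN _] := mingroupp minN.
have [x Nx ntx] := trivgPn _ ntN.
suffices: N \subset <[x]> by move/cyclicS; apply; apply: cycle_cyclic.
have cGx : G \subset 'C(<[x]>).
  by rewrite cent_cycle (subset_trans cGN) // -cent_set1 centS ?sub1set.
apply: (minnormal_sub minN (subset_trans cGx (cent_sub _))).
apply/trivgPn; exists x => //; rewrite inE Nx cycle_id //.
Qed.

(** If the normalizer K of <[x]> had index 2, it would centralize [N]; for g outside K, the product
    of x and x ^ g would then be a nontrivial element of [N] central in [G], which is impossible for
    noncyclic [N]. *)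
Lemma order2_class_gt2 (gT : finGroupType) (G N : {group gT}) x :
    minnormal N G -> abelian N -> ~~ cyclic N -> N \subset G ->
  x \in N -> #[x] = 2 -> (2 < #|orbit 'JG%act G <[x]>%G|)%N.
Proof.
move=> minN cNN ncN sNG Nx ox; have /andP[ntN nNG] := mingroupp minN.
have Gx := subsetP sNG x Nx.
have ntx : x != 1 by rewrite -order_gt1 ox.
have not_normed y : y \in N -> y != 1 -> ~~ (G \subset 'N(<[y]>)).
  move=> Ny nty; apply: contra ncN => nyG.
  apply: cyclicS (cycle_cyclic y); apply: minnormal_sub minN nyG _.
  by apply/trivgPn; exists y; rewrite // inE Ny cycle_id.
rewrite card_orbitJG /=; have := indexg_gt0 G 'N_G(<[x]>).
case oI: #|G : 'N_G(<[x]>)| => [|[|[|n]]] // _.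
  move/eqP: oI; rewrite indexg_eq1 subsetI subxx /= => nxG.
  by case/negP: (not_normed x Nx ntx).
set K := 'N_G(<[x]>) in oI.
have nKG : K <| G by rewrite index2_normal ?subsetIl.
(* A group of order 2 has a single nontrivial element, so normalizing it means centralizing it. *)
have cKx : K \subset 'C[x].
  apply/subsetP=> k /setIP[_ /normP nxk]; apply/cent1P/commute_sym/commgP/conjg_fixP.
  have : x ^ k \in <[x]> by rewrite -nxk memJ_conjg cycle_id.
  have /eqP/setP-> : <[x]> == [set 1; x].
    rewrite eq_sym eqEcard -[#|<[_]>|]/(#[x]) ox cards2 eq_sym ntx andbT.
    by rewrite subUset !sub1set group1 cycle_id.
  by rewrite !inE conjg_eq1 (negPf ntx) => /eqP.
have cKN : K \subset 'C(N).
  rewrite centsC; have: N \subset 'C_G(K).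
    apply: minnormal_sub minN _ _.
      by rewrite normsI ?normG ?norms_cent ?normal_norm.
    apply/trivgPn; exists x => //; rewrite !inE Nx Gx /=.
    by apply/centP=> k /(subsetP cKx)/cent1P/commute_sym.
  by rewrite subsetI => /andP[].
have [g Gg nKg] : exists2 g, g \in G & g \notin K.
  apply/subsetPn; apply/negP=> sGK.
  by move: (not_normed x Nx ntx); rewrite (subset_trans sGK) ?subsetIr.
have Ng := subsetP (normal_norm nKG) g Gg.
have Kg2 : g ^+ 2 \in K.
  rewrite coset_idr ?groupX // morphX //.
  have <-: #|G / K| = 2 by rewrite card_quotient ?normal_norm.
  by rewrite expg_cardG ?mem_quotient.
have Nxg : x ^ g \in N by rewrite memJ_norm // (subsetP nNG).
have cxg : commute x (x ^ g) by apply: (centsP cNN).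
(* [g] swaps the two factors, as its square centralizes [x], and the factors commute. *)
pose y := x * x ^ g; have Ny : y \in N by rewrite groupM.
have yg : y ^ g = y.
  have := subsetP cKx _ Kg2; move/cent1P/commute_sym/commgP/conjg_fixP => xg2.
  by rewrite conjMg -conjgM xg2 /y cxg.
have nty : y != 1.
  apply: contra nKg => /eqP y1; rewrite inE Gg.
  rewrite inE -cycleJ cycle_subG.
  rewrite (_ : x ^ g = x^-1) ?groupV ?cycle_id //.
  by apply/eqP; rewrite eq_sym eq_invg_mul -/y y1.
case/negP: (not_normed y Ny nty); rewrite cents_norm // cent_cycle.
(* The centralizer of [y] contains the maximal subgroup [K] and also [g], so it is all of [G]. *)
have /maxgroupP[_ maxK] : maximal K G by rewrite p_index_maximal ?subsetIl ?oI.
have sKy : K \subset 'C_G[y].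
  by rewrite subsetI subsetIl sub_cent1 (subsetP _ y Ny) // centsC.
have : ~~ ('C_G[y] \proper G).
  apply: contra nKg => prC; have <- : 'C_G[y] = K := maxK _ prC sKy.
  rewrite inE Gg.
  by apply/cent1P/commute_sym/commgP/conjg_fixP.
by rewrite properE subsetIl negbK subsetI subxx.
Qed.

Lemma mulg_norm (gT : finGroupType) (G N M A : {group gT}) :
  N * M = G -> N \subset 'N(A) -> M \subset 'N(A) -> G \subset 'N(A).
Proof. by move=> <- nAN nAM; rewrite mul_subG. Qed.

(** Under these hypotheses [G] acts primitively on the cosets of [M], with [N] as regular normal
    subgroup. *)
Lemma dprime_primitive (gT : finGroupType) (G N M : {group gT}) :
    minnormal N G -> abelian N -> ~~ cyclic N -> N * M = G -> N :&: M = 1 ->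
    (forall D : {group gT}, D <| G -> D :!=: 1 -> N \subset D) ->
  (dprime G <= 1 / 2%:R)%R.
Proof.
move=> minN cNN ncN defG tiNM minU; have /andP[ntN nNG] := mingroupp minN.
have [sNG sMG] : N \subset G /\ M \subset G by rewrite -defG mulG_subl mulG_subr.
have nsN : N <| G by apply/andP.
have normN (A : {group gT}) : A \subset N -> M \subset 'N(A) -> A :!=: 1 -> N \subset A.
  move=> sAN nAM ntA; apply: minU => //; rewrite /normal (subset_trans sAN) //=.
  by apply: (mulg_norm defG) => //; rewrite cents_norm // centsC (subset_trans sAN).
(* This centralizer is normalized by [M] and centralized by [N], hence normal in [G]; if nontrivial
   it would contain [N], although [M] meets [N] trivially. *)
have faithM : 'C_M(N) = 1.
  apply: contraNeq ntN => ntCM; rewrite -subG1 -tiNM subsetI subxx /=.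
  apply: subset_trans (subsetIl M 'C(N)); apply: minU => //.
  rewrite /normal (subset_trans (subsetIl _ _)) //=; apply: (mulg_norm defG).
    by rewrite cents_norm // centsC subsetIr.
  by rewrite normsI ?normG ?norms_cent // (subset_trans sMG).
pose S := normal_subgroups G :\ 1%G :\ N.
have inS H : H \in S -> [/\ H <| G, N * (M :&: H) = H & M :&: H :!=: 1].
  rewrite !inE => /and3P[neHN neH1 nsH].
  have ntH : H :!=: 1 by apply: contraNneq neH1 => H1; apply/eqP/group_inj.
  have defH : N * (M :&: H) = H.
    by rewrite group_modl ?minU // defG; apply/setIidPr/normal_sub.
  split=> //; apply: contraNneq neHN => K1; apply/eqP/group_inj.
  by rewrite -defH K1 mulg1.
pose cls (H : {group gT}) := orbit 'JG%act G (M :&: H)%G.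
have cls_card H : H \in S -> #|N| <= #|cls H|.
  move=> /inS[nsH defH ntK]; set K := M :&: H in defH ntK.
  have nKM : M \subset 'N(K).
    by rewrite normsI ?normG // (subset_trans sMG) ?normal_norm.
  have sKM : K \subset M := subsetIl _ _.
  have cNK : 'C_N(K) = 1.
    apply: contraNeq ntK => ntC; rewrite -subG1 -faithM subsetI sKM /=.
    have: N \subset 'C_N(K).
      apply: normN => //; first exact: subsetIl.
      by rewrite normsI ?norms_cent // (subset_trans sMG).
    by rewrite subsetI centsC => /andP[].
  (* The commutator of [K] with its normalizer in [N] lies in both [N] and [M], so that normalizer
     centralizes [K]. *)
  have tiNK : N :&: 'N_G(K) = 1.
    apply/trivgP; rewrite -cNK /= setIA (setIidPl sNG) subsetI subsetIl /=.
    rewrite (sameP commG1P trivgP) -tiNM subsetI.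
    rewrite (subset_trans _ (subsetIl N 'N(K))) ?commg_subl /=; last first.
      by rewrite normsI // ?(subset_trans _ nNG) ?(subset_trans sKM) // normsG ?normG.
    by rewrite (subset_trans _ sKM) // commg_subr subsetIr.
  rewrite card_orbitJG -(leq_pmul2l (cardG_gt0 'N_G(K))) Lagrange ?subsetIl //.
  by rewrite mulnC -TI_cardMg // subset_leq_card // mul_subG // subsetIl.
(* [N] is normal and H = N (M :&: H), so conjugate intersections give conjugate, hence equal, normal
   subgroups. *)
have cls_inj : {in S &, injective cls}.
  move=> H1 H2 /inS[nsH1 defH1 _] /inS[nsH2 defH2 _] eq_cls.
  have /mem_orbitJG[g Gg /= defK]: (M :&: H1)%G \in cls H2 by rewrite -eq_cls orbit_refl.
  apply: val_inj; rewrite /= -defH1 defK -(normsP nNG g Gg) -conjsMg defH2.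
  exact: normsP (normal_norm nsH2) g Gg.
have S_gt0 : 0 < #|S|.
  apply/card_gt0P; exists G; rewrite !inE normal_refl andbT; apply/andP; split.
    apply: contraNneq (noncyclic_minnormal_cent minN ncN) => ->; exact: cNN.
  by apply: contraNneq ntN => G1; rewrite -subG1 (subset_trans sNG) ?G1.
have card_normal : #|normal_subgroups G| <= #|S| + 2.
  rewrite (cardsD1 1%G) (cardsD1 N (_ :\ _)) -/S addnA addnC leq_add2l.
  by rewrite -[2]/(1 + 1) leq_add ?leq_b1.
have sum_cls : #|S| * (#|N| - 2) <= \sum_(c in cls @: S) (#|c| - 2).
  rewrite big_imset //= -sum_nat_const; apply: leq_sum => H SH.
  exact: leq_sub2r (cls_card H SH).
have sub_cls : cls @: S \subset subgroup_classes G.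
  apply/subsetP=> _ /imsetP[H _ ->]; apply: subgroup_classes_orbit.
  by rewrite (subset_trans (subsetIl _ _)).
have N_gt3 : 3 < #|N|.
  rewrite leqNgt; apply: contra ncN; have := cardG_gt0 N.
  case oN: #|N| => [|[|[|[|n]]]] // _ _.
  - by rewrite (card1_trivg oN) cyclic1.
  - by rewrite prime_cyclic ?oN.
  - by rewrite prime_cyclic ?oN.
have [N_gt4 | N_le4] := ltnP 4 #|N|.
  apply: (@dprime_le_half_excess_classes _ G (cls @: S)) => //.
  apply: leq_trans card_normal (leq_trans _ sum_cls).
  (* Each class has excess at least 3, and |S| + 2 <= 3 |S| since [S] is not empty. *)
  case: #|S| S_gt0 => // m _; apply: (@leq_trans (m.+1 * 3)); first by lia.
  by rewrite leq_mul2l ltn_subRL.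
have oN : #|N| = 4 by apply/eqP; rewrite eqn_leq N_le4.
(* Now the excess per class is only known to be 2, and |S| + 2 <= 2 |S| fails for |S| = 1; the class
   of <[x]> supplies the missing 1. *)
have [//| |x Nx ox] := @Cauchy _ 2 N; first by rewrite oN.
have clx : 2 < #|orbit 'JG%act G <[x]>%G| := order2_class_gt2 minN cNN ncN sNG Nx ox.
apply: (@dprime_le_half_excess_classes _ G (orbit 'JG%act G <[x]>%G |: cls @: S)).
  by rewrite subUset sub1set sub_cls subgroup_classes_orbit // cycle_subG (subsetP sNG).
rewrite big_setU1 /=; last first.
  apply/imsetP=> -[H SH eq_cls]; have [nsH defH ntK] := inS H SH.
  have /mem_orbitJG[g Gg /= defK]: (M :&: H)%G \in orbit 'JG%act G <[x]>%G.
    by rewrite eq_cls orbit_refl.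
  have sKN : M :&: H \subset N by rewrite defK -(normsP nNG g Gg) conjSg cycle_subG.
  by case/negP: ntK; rewrite -subG1 -tiNM subsetI sKN subsetIl.
apply: leq_trans card_normal _; rewrite oN in sum_cls.
have clx1 : 1 <= #|orbit 'JG%act G <[x]>%G| - 2 by rewrite subn_gt0.
apply: leq_trans (leq_add clx1 sum_cls).
by case: #|S| S_gt0 => // m _; lia.
Qed.

(** * The induction on the order of the group *)

Lemma sections_gt_half_supersolvable (gT : finGroupType) (G : {group gT}) :
  dprime_sections_gt_half G -> supersolvable G.
Proof.
have [n] := ubnP #|G|; elim: n => // n IHn in gT G * => /ltnSE-leGn gtG.
have [G1|ntG] := eqsVneq G 1.
  by exists [::] => //=; apply: val_inj; rewrite /= G1.
have dG := sections_gt_half_self gtG.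
have IHs (H : {group gT}) : H \subset G -> H :!=: G -> supersolvable H.
  move=> sHG neHG; apply: IHn (sections_gt_halfS sHG gtG).
  by apply: leq_trans leGn; rewrite proper_card // properEneq neHG.
have IHq (D : {group gT}) : D <| G -> D :!=: 1 -> supersolvable (G / D)%G.
  move=> nDG ntD; apply: IHn (sections_gt_half_quotient nDG gtG).
  by apply: leq_trans leGn; rewrite ltn_quotient ?normal_sub.
have [N minN sNG] := minnormal_exists ntG (normG G).
have nsN := minnormal_normal minN sNG.
have /andP[ntN nNG] := mingroupp minN.
have [cycN|ncN] := boolP (cyclic N).
  exact: supersolvable_cyclic_ext (supersolvable_from_quotient nsN (IHq _ nsN ntN)).
(* If [N] met [D] trivially, the series from [D] to [G] lifted from [G / D] would make [N]
   cyclic. *)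
have minU (D : {group gT}) : D <| G -> D :!=: 1 -> N \subset D.
  move=> nD ntD; apply: (minnormal_sub minN (normal_norm nD)).
  apply: contra ncN => /eqP; apply: (minnormal_cyclic _ minN sNG).
  exact: supersolvable_from_quotient (IHq D nD ntD).
have ncG := noncyclic_minnormal_cent minN ncN.
have solN : solvable N.
  have [defN|neNG] := eqVneq N G; last exact: supersolvable_solvable (IHs _ sNG neNG).
  rewrite defN; apply: abelian_sol; apply: contraLR dG => ncGG; rewrite -leNgt.
  apply: dprime_simple => //; apply/simpleP; split=> // H nsH.
  have [->|ntH] := eqsVneq H 1; [by left | right].
  by apply/eqP; rewrite eqEsubset normal_sub //= -{1}defN minU.
have [_ _ /is_abelemP[p p_pr abelN]] := minnormal_solvable minN (subxx N) solN.
have cNN := abelem_abelian abelN.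
pose C := 'C_G(N)%G.
have nsC : C <| G by rewrite /normal subsetIl normsI ?normG ?norms_cent.
have sNC : N \subset C by rewrite subsetI sNG.
have ntC : C :!=: 1 by apply: contraNneq ntN => C1; rewrite -subG1 -C1.
have solGC := supersolvable_solvable (IHq C nsC ntC).
have ntGC : (G / C)%G :!=: 1.
  by rewrite -subG1 quotient_sub1 ?normal_norm // subsetI subxx.
have [Kb minKb sKb] := minnormal_exists ntGC (normG _).
have [_ ntKb /is_abelemP[q q_pr /abelem_pgroup qKb]] :=
  minnormal_solvable minKb sKb solGC.
have [K defK sCK nsK] := inv_quotientN nsC (minnormal_normal minKb sKb).
have [Q sylQ] := Sylow_exists q K.
have sQK := pHall_sub sylQ; have nCK := subset_trans (normal_sub nsK) (normal_norm nsC).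
(* [K / C] is a q-group, so the Sylow subgroup [Q] maps onto it. *)
have defKQ : C * Q = K.
  have sylQC := quotient_pHall (subset_trans sQK nCK) sylQ.
  rewrite defK in qKb; have /(congr1 (fun A => coset C @*^-1 A)) := pHall_id sylQC qKb.
  by rewrite quotientK ?(subset_trans sQK) // quotientGK ?(normalS sCK (normal_sub nsK)).
have defCG : C * 'N_G(Q) = G.
  have := Frattini_arg nsK sylQ; rewrite -{1}defKQ -mulgA mulSGid //.
  by rewrite subsetI (subset_trans sQK (normal_sub nsK)) normG.
pose X := (N <*> 'N_G(Q))%G.
have nNN : 'N_G(Q) \subset 'N(N) by rewrite (subset_trans (subsetIl _ _)).
have defX : N * 'N_G(Q) = G.
  have sXG : X \subset G by rewrite join_subG sNG subsetIl.
  rewrite -norm_joinEr //; apply/eqP; apply: contraNT ncN => neXG.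
  have sNX : N \subset X := joing_subl _ _.
  have ssX : supersolvable_from X 1%G := IHs X sXG neXG.
  apply: (minnormal_cyclic ssX _ sNX); last exact/setIidPr/sub1G.
  (* A subgroup [A] of [N] is centralized by [C]; if [X] normalizes it, so does G = C N_G(Q), and
     minimality in [G] applies. *)
  apply/mingroupP; split=> [|A /andP[ntA nAX] sAN].
    by rewrite ntN (subset_trans sXG).
  case/mingroupP: minN => _; apply=> //; rewrite ntA -defCG mul_subG //.
    by rewrite cents_norm // centsC (subset_trans sAN) // centsC subsetIr.
  by rewrite (subset_trans _ nAX) ?joing_subr.
have tiX : N :&: 'N_G(Q) = 1.
  have nI : G \subset 'N(N :&: 'N_G(Q)).
    apply: (mulg_norm defX).
      by rewrite cents_norm // centsC (subset_trans (subsetIl _ _)).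
    by rewrite normsI ?normG.
  (* Otherwise [N] normalizes [Q], so [Q] is normal in [G] and contains [N]. Then [N] meets the
     centre of the q-group [Q], hence lies in it, so [Q] lies in [C] and K = C, a contradiction. *)
  apply/eqP; apply: contraNT ncG => ntI.
  have sNN : N \subset 'N_G(Q).
    have: N \subset N :&: 'N_G(Q).
      by apply: (minnormal_sub minN nI); rewrite /= setIA setIid.
    by rewrite subsetI => /andP[].
  have nsQ : Q <| G.
    rewrite /normal (subset_trans sQK (normal_sub nsK)).
    by rewrite (mulg_norm defX) ?subsetIr // (subset_trans sNN) ?subsetIr.
  have ntQ : Q :!=: 1.
    apply: contraNneq ntKb => Q1; rewrite defK -subG1 quotient_sub1 //.
    by rewrite -defKQ Q1 mulg1.
  have sNQ := minU Q nsQ ntQ.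
  have nsNQ := normalS sNQ (normal_sub nsQ) nsN.
  have ntZ := meet_center_nil (pgroup_nil (pHall_pgroup sylQ)) nsNQ ntN.
  have sNZ : N \subset 'Z(Q).
    exact: minnormal_sub minN (gFnorm_trans _ (normal_norm nsQ)) ntZ.
  case/negP: ntKb; rewrite defK -subG1 quotient_sub1 // -defKQ mul_subG //.
  rewrite subsetI (normal_sub nsQ) centsC.
  by rewrite (subset_trans sNZ) // subsetIr.
move: dG; rewrite ltNge; case/negP.
exact: dprime_primitive minN cNN ncN defX tiX minU.
Qed.

(** * Groups of order 12 without a normal subgroup of order 3 *)

Lemma dprime_abelian (gT : finGroupType) (G : {group gT}) :
  abelian G -> dprime G = 1%R.
Proof.
move=> cGG; rewrite /dprime /subgroup_classes card_in_imset.
  by rewrite divff // pnatr_eq0 -lt0n card_subgroups_gt0.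
move=> A B; rewrite !inE => sAG sBG eqAB; apply: group_inj.
have /mem_orbitJG[g Gg ->]: A \in orbit 'JG%act G B by rewrite -eqAB orbit_refl.
exact: normsP (sub_abelian_norm cGG sBG) g Gg.
Qed.

(** Conjugate subgroups have equal orders, so distinct orders mean distinct classes. [f] reads the
    order off a class, with default 0 for the empty set. *)
Lemma size_subgroup_orders (gT : finGroupType) (G : {group gT})
    (s : seq {group gT}) :
    {subset s <= subgroups G} -> uniq [seq #|H| | H : {group gT} <- s] ->
  size s <= #|subgroup_classes G|.
Proof.
move=> sG; pose f (c : {set {group gT}}) :=
  oapp (fun H : {group gT} => #|H|) 0 [pick H in c].
have fE (H : {group gT}) : f (orbit 'JG%act G H) = #|H|.
  by rewrite /f; case: pickP => [K /class_card | /(_ H)] //; rewrite orbit_refl.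
rewrite -(eq_map fE) (map_comp f) => /map_uniq Us.
rewrite -(size_map (orbit 'JG%act G)) cardE; apply: uniq_leq_size => // _ /mapP[H sH ->].
by rewrite mem_enum imset_f ?sG.
Qed.

Lemma abelian_card_le4 (gT : finGroupType) (G : {group gT}) :
  #|G| <= 4 -> abelian G.
Proof.
case oG: #|G| => [|[|[|[|[|n]]]]] // _.
- by have := cardG_gt0 G; rewrite oG.
- by rewrite (card1_trivg oG) abelian1.
- by rewrite cyclic_abelian ?prime_cyclic ?oG.
- by rewrite cyclic_abelian ?prime_cyclic ?oG.
- by apply: (@card_p2group_abelian _ 2).
Qed.

Lemma dvd12 n : n %| 12 -> n \in [:: 1%N; 2; 3; 4; 6; 12].
Proof. by rewrite dvdn_divisors. Qed.

(** The divisors of 12 congruent to 1 modulo 3 are 1 and 4, and 1 would make [P] normal. The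
    normalizer of index 4 has order 3. *)
Lemma order12_self_norm (gT : finGroupType) (G P : {group gT}) :
    #|G| = 12 -> (forall H : {group gT}, H <| G -> #|H| <> 3) ->
    P \subset G -> #|P| = 3 ->
  #|'Syl_3(G)| = 4 /\ 'N_G(P) = P.
Proof.
move=> oG no3 sPG oP.
have sylP : 3.-Sylow(G) P by rewrite pHallE sPG oP oG p_part.
have oI := card_Syl sylP.
have n3 : #|'Syl_3(G)| = 4.
  have := card_Syl_dvd 3 G; have := card_Syl_mod G (isT : prime 3).
  rewrite oG => mod3 /dvd12; rewrite !inE.
  case/or4P=> [/eqP n1|/eqP n2|/eqP n3|/or3P[/eqP //|/eqP n6|/eqP n12]].
  - case: (no3 P) => //; rewrite /normal sPG /=.
    by move/eqP: n1; rewrite oI indexg_eq1 subsetI subxx.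
  - by rewrite n2 in mod3.
  - by rewrite n3 in mod3.
  - by rewrite n6 in mod3.
  - by rewrite n12 in mod3.
split=> //; apply/eqP; rewrite eq_sym eqEcard subsetI sPG normG /= oP.
have := Lagrange (subsetIl G 'N(P)); rewrite -oI n3 oG.
by move/eqP; rewrite -[12]/(3 * 4)%N eqn_pmul2r // => /eqP->.
Qed.

(** A group of order 6 has a unique Sylow 3-subgroup P, so it would lie in N_G(P) = P. *)
Lemma order12_no6 (gT : finGroupType) (G H : {group gT}) :
    #|G| = 12 -> (forall H : {group gT}, H <| G -> #|H| <> 3) ->
  H \subset G -> #|H| <> 6.
Proof.
move=> oG no3 sHG oH.
have [P sylP] := Sylow_exists 3 H.
have sPH := pHall_sub sylP.
have oP : #|P| = 3 by rewrite (card_Hall sylP) oH p_part.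
have [_ NP] := order12_self_norm oG no3 (subset_trans sPH sHG) oP.
have: #|'Syl_3(H)| \in [:: 1%N; 2; 3; 6].
  by have := card_Syl_dvd 3 H; rewrite oH dvdn_divisors.
have := card_Syl_mod H (isT : prime 3).
rewrite !inE => mod3 /or4P[] /eqP n3; rewrite n3 // in mod3.
move/eqP: n3; rewrite (card_Syl sylP) indexg_eq1 subsetI subxx /= => nPH.
have: H \subset 'N_G(P) by rewrite subsetI sHG.
by rewrite NP => /subset_leq_card; rewrite oP oH.
Qed.

Lemma order12_no_normal2 (gT : finGroupType) (G D : {group gT}) :
    #|G| = 12 -> (forall H : {group gT}, H <| G -> #|H| <> 3) ->
  D <| G -> #|D| <> 2.
Proof.
move=> oG no3 /andP[sDG nDG] oD.
have [P sylP] := Sylow_exists 3 G.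
have sPG := pHall_sub sylP.
have oP : #|P| = 3 by rewrite (card_Hall sylP) oG p_part.
have sDPG : D <*> P \subset G by rewrite join_subG sDG.
apply: (order12_no6 oG no3 sDPG).
rewrite /= norm_joinEr ?(subset_trans sPG) // TI_cardMg ?oD ?oP //.
by apply: coprime_TIg; rewrite oD oP.
Qed.

Lemma order12_section (gT : finGroupType) (G : {group gT}) (s : section gT) :
    #|G| = 12 -> (forall H : {group gT}, H <| G -> #|H| <> 3) ->
    section_in G s ->
  dprime_section s = 1%R \/ dprime_section s = dprime G.
Proof.
move=> oG no3; case: s => [[H N]] /andP[/= sHG nsN]; rewrite /dprime_section /=.
have dH : #|H| %| 12 by rewrite -oG cardSg.
have [H4|] := leqP #|H| 4.
  left; apply: dprime_abelian; exact: quotient_abelian (abelian_card_le4 H4).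
move/dvd12: dH; rewrite !inE.
case/or4P=> [/eqP->|/eqP->|/eqP->|/or3P[/eqP->|/eqP o6 _|/eqP o12 _]] //.
  by case: (order12_no6 oG no3 sHG o6).
have defH : H :=: G by apply/eqP; rewrite eqEcard sHG oG o12.
rewrite (group_inj defH) in nsN *.
have dN : #|N| %| 12 by rewrite -oG cardSg ?normal_sub.
have oGN : #|G / N| = 12 %/ #|N|.
  by rewrite card_quotient ?normal_norm // -divgS ?normal_sub ?oG.
move/dvd12: dN; rewrite !inE; case/or4P=> [/eqP o1|/eqP o2|/eqP o3|dN'].
- right; rewrite (group_inj (card1_trivg o1 : N :=: 1%G)).
  by rewrite -(dprime_isog (quotient1_isog G)).
- by case: (order12_no_normal2 oG no3 nsN o2).
- by case: (no3 N nsN o3).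
(* [N] has order 4, 6 or 12 here, so the quotient has order at most 3. *)
left; apply: dprime_abelian; apply: abelian_card_le4; rewrite /= oGN.
by case/or3P: dN' => /eqP->.
Qed.

(** A minimal normal subgroup would be cyclic and elementary abelian, hence of order 2 or 3; neither
    order occurs. *)
Lemma order12_not_supersolvable (gT : finGroupType) (G : {group gT}) :
    #|G| = 12 -> (forall H : {group gT}, H <| G -> #|H| <> 3) ->
  ~ supersolvable G.
Proof.
move=> oG no3 ssG; have solG := supersolvable_solvable ssG.
have ntG : G :!=: 1 by rewrite -cardG_gt1 oG.
have [N minN sNG] := minnormal_exists ntG (normG G).
have [_ ntN /is_abelemP[p p_pr abelN]] := minnormal_solvable minN sNG solG.
have nsN := minnormal_normal minN sNG.
have cycN : cyclic N.
  apply: (minnormal_cyclic (ssG : supersolvable_from G 1%G) minN sNG).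
  exact/setIidPr/sub1G.
have oN := cyclic_abelem_prime abelN cycN ntN.
have := cardSg sNG; rewrite oG oN => /dvd12; rewrite !inE.
case/or4P=> [/eqP p1|/eqP p2|/eqP p3|/or3P[] /eqP pE]; rewrite ?p1 ?pE // in p_pr.
  by apply: (order12_no_normal2 oG no3 nsN); rewrite oN.
by apply: (no3 N nsN); rewrite oN.
Qed.

(** The orders 1, 2, 3, 4 and 12 give at least five classes, and there are at most ten subgroups. *)
Lemma order12_dprime_ge_half (gT : finGroupType) (G : {group gT}) :
    #|G| = 12 -> (forall H : {group gT}, H <| G -> #|H| <> 3) ->
  (1 / 2%:R <= dprime G)%R.
Proof.
move=> oG no3; rewrite dprime_ge_half.
have [//| |x Gx ox] := @Cauchy _ 3 G; first by rewrite oG.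
have sxG : <[x]> \subset G by rewrite cycle_subG.
have [n3 Nx] := order12_self_norm oG no3 sxG ox.
have card_cl y : y \in G -> <[y]> = <[x]> -> #|y ^: G| = 4.
  move=> Gy yx; rewrite -index_cent1 -divgS ?subsetIl //= oG.
  suffices ->: 'C_G[y] = <[x]> by rewrite -[#|_|]/(#[x]) ox.
  have cxy : <[x]> \subset 'C[y] by rewrite -yx -cent_cycle; apply: cycle_abelian.
  apply/eqP; rewrite eqEsubset (subsetI <[x]>) sxG cxy !andbT.
  have: 'C_G[y] \subset 'N_G(<[x]>) by rewrite setIS // -cent_cycle yx cent_sub.
  by rewrite Nx.
(* Removing eight elements of order 3 leaves four, which must form any subgroup of order 4. *)
pose T := G :\: (x ^: G :|: x^-1 ^: G).
have oT : #|T| = 4.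
  rewrite cardsD (setIidPr _) ?subUset ?class_subG ?groupV // oG cardsU.
  rewrite (card_cl x) // (card_cl x^-1) ?groupV ?cycleV //.
  (* If [g] inverted [x], it would normalize <[x]>, hence lie in it and commute with [x], so the
     order of [x] would divide 2. *)
  rewrite disjoint_setI0 ?cards0 //; apply/pred0P=> y /=.
  apply/negP=> /andP[/class_eqP eqy1 /class_eqP eqy2].
  have /imsetP[g Gg xg] : x^-1 \in x ^: G by rewrite -eqy1 eqy2 class_refl.
  have : g \in 'N_G(<[x]>) by rewrite 2!inE Gg /= -cycleJ -xg cycleV.
  rewrite Nx => /(subsetP (cycle_abelian x))/centP/(_ x (cycle_id x)).
  move/commute_sym/commgP/conjg_fixP.
  rewrite -xg => /esym/eqP; rewrite eq_sym eq_invg_mul => /eqP xx.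
  suffices : #[x] %| 2 by rewrite ox.
  by rewrite order_dvdn expgS expg1 xx.
have order3 y : y \in G -> #[y] != 3 -> y \in T.
  move=> Gy; apply: contraR; rewrite !inE Gy andbT negbK.
  by case/orP=> /imsetP[g _ ->]; rewrite orderJ ?orderV ox.
have T1 : 1 \in T by rewrite order3 ?order1.
have sub4 (H : {group gT}) : H \subset G -> #|H| = 4 -> H :=: T.
  move=> sHG oH; apply/eqP; rewrite eqEcard oH oT andbT; apply/subsetP=> y Hy.
  apply: order3 (subsetP sHG y Hy) _; apply: contraTneq (order_dvdG Hy) => ->.
  by rewrite oH.
have [V sylV] := Sylow_exists 2 G.
have sVG := pHall_sub sylV.
have oV : #|V| = 4 by rewrite (card_Hall sylV) oG p_part.
have [//| |z Gz oz] := @Cauchy _ 2 G; first by rewrite oG.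
apply: (@leq_trans 10); last first.
  rewrite -[10]/(2 * 5)%N leq_mul2l /=.
  apply: (@size_subgroup_orders _ G [:: 1%G; <[z]>%G; <[x]>%G; V; G]).
    move=> H; rewrite !inE => /or4P[/eqP->|/eqP->|/eqP->|/orP[]/eqP->] //.
      exact: sub1G.
    by rewrite cycle_subG.
  by rewrite /= -![#|<[_]>|]/(#[_]) cards1 oz ox oV oG.
(* Three listed subgroups, four of order 3, and at most three of order 2, generated by the
   nontrivial elements of [T]. *)
pose L := [set 1%G; G; V] :|: ('Syl_3(G) :|: [set <[y]>%G | y in T :\ 1]).
apply: (@leq_trans #|L|).
  apply/subset_leq_card/subsetP=> H; rewrite inE => sHG.
  have := cardSg sHG; rewrite oG => /dvd12; rewrite !inE.
  case/or4P=> [/eqP o1|/eqP o2|/eqP o3|/or3P[/eqP o4|/eqP o6|/eqP o12]].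
  - by rewrite (group_inj (card1_trivg o1 : H :=: 1%G)) eqxx.
  - have [y Hy nty] : exists2 y, y \in H & y != 1.
      by apply/trivgPn; rewrite -cardG_gt1 o2.
    apply/or3P; apply: Or33; apply/imsetP; exists y.
      rewrite in_setD1 nty order3 ?(subsetP sHG) //.
      by apply: contraTneq (order_dvdG Hy) => ->; rewrite o2.
    apply/group_inj/eqP; rewrite eq_sym eqEcard cycle_subG Hy o2.
    by rewrite -[#|_|]/(#[y]) order_gt1.
  - by rewrite pHallE sHG o3 oG p_part /= orbT.
  - suffices -> : H = V by rewrite eqxx !orbT.
    exact/group_inj/(etrans (sub4 H sHG o4))/esym/(sub4 V sVG oV).
  - by case: (order12_no6 oG no3 sHG o6).
  suffices -> : H = G by rewrite eqxx !orbT.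
  by apply/group_inj/eqP; rewrite eqEcard sHG oG o12.
apply: leq_trans (leq_card_setU _ _) _; rewrite -[10]/(3 + (4 + 3)).
apply: leq_add.
  rewrite (leq_trans (leq_card_setU _ _)) // cards1 cards2 addn1 ltnS.
  by case: (_ != _).
apply: leq_trans (leq_card_setU _ _) _; rewrite n3 leq_add2l.
rewrite (leq_trans (leq_imset_card _ _)) //.
by rewrite -ltnS -[(#|_|).+1]/(true + _) -T1 -cardsD1 oT.
Qed.

(** The action on four points is 2-transitive, hence primitive: a normal subgroup acts trivially, so
    is trivial by faithfulness, or transitively, so has order divisible by 4. *)
Lemma Alt4_no_normal3 (H : {group {perm 'I_4}}) : H <| 'Alt_('I_4) -> #|H| <> 3.
Proof.
move=> nsH oH.
have prim : [primitive 'Alt_('I_4), on [set: 'I_4] | 'P].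
  apply: (@ntransitive_primitive _ _ _ _ _ 2) => //.
  by have := Alt_trans 'I_4; rewrite card_ord.
have [fixH|trH] := prim_trans_norm prim nsH.
  have faith := aperm_faithful 'Alt_('I_4).
  have /trivgP H1 := subset_trans fixH faith.
  by rewrite H1 cards1 in oH.
by have := atrans_dvd trH; rewrite oH cardsT card_ord.
Qed.

Lemma card_Alt4 : #|'Alt_('I_4)| = 12.
Proof. by apply: double_inj; rewrite -mul2n card_Alt card_ord. Qed.

Theorem mainTheorem2 :
  dstar 'Alt_('I_4) = (1 / 2%:R)%R /\
  dprime 'Alt_('I_4) = (1 / 2%:R)%R /\
  (forall (gT : finGroupType) (G : {group gT}),
     (1 / 2%:R < dstar G)%R -> supersolvable G).
Proof.
have ss_gt (gT : finGroupType) (G : {group gT}) :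
    (1 / 2%:R < dstar G)%R -> supersolvable G.
  move=> gtG; apply: sections_gt_half_supersolvable => s Gs.
  by have [_ /(_ s Gs)] := dstarP G; apply: lt_le_trans.
have no3 := Alt4_no_normal3; have o12 := card_Alt4.
have dge := order12_dprime_ge_half o12 no3.
(* The upper bound is the criterion itself, applied to the non-supersolvable group A_4. *)
have dle : (dstar 'Alt_('I_4) <= 1 / 2%:R)%R.
  rewrite leNgt; apply/negP=> /ss_gt; exact: order12_not_supersolvable.
have [[s Gs ds] _] := dstarP 'Alt_('I_4)%G.
(* The minimizing section has d' equal to 1, too large, or to d'(A_4), which is then squeezed
   between the two bounds. *)
have [d1|dG] := order12_section o12 no3 Gs.
  by rewrite ds d1 in dle.
have eq_half : dprime 'Alt_('I_4) = (1 / 2%:R)%R.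
  by apply/eqP; rewrite eq_le dge -dG -ds dle.
by rewrite ds dG; split.
Qed.
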